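(* Let $0<q<m$ be coprime integers. We have $$\frac{m^2}{mq-1}=[\mathtt W_0^\vee,10,\mathtt W_1^\vee]$$ for some non-empty Wahl chains $\mathtt W_i$ (where $\mathtt W_i^\vee$ are dual Wahl chains) if and only if $m$ is a Markov number. In fact, if $\frac{n_0^2}{n_0a_0-1}=\mathtt W_0$ and $\frac{n_1^2}{n_1a_1-1}=\mathtt W_1$, then $n_0^2+n_1^2+m^2=3n_0n_1m$.
   Context: A Markov triple is a positive integer solution of $x^2+y^2+z^2=3xyz$; the integers that appear in Markov triples are the Markov numbers. The Hirzebruch-Jung continued fraction is $[e_1,\dots,e_r]=e_1-\cfrac1{e_2-\cfrac1{\ddots-\cfrac1{e_r}}}$; each rational number $>1$ is uniquely $[e_1,\dots,e_r]$ with all $e_i\ge2$, called its chain. If $\frac mq=[x_1,\dots,x_r]$ and $\frac m{m-q}=[y_1,\dots,y_s]$ are the chains of these fractions, then $\frac{m^2}{mq-1}=[x_1,\dots,x_r+y_s,\dots,y_1]$. A Wahl chain $\mathtt W$ is the chain of $\frac{n^2}{na-1}$ for coprime integers $0<a<n$ (written $\frac{n^2}{na-1}=\mathtt W$); its dual Wahl chain $\mathtt W^\vee$ is the chain of $\frac{n^2}{n^2-na+1}$. The notation $[\mathtt W_0^\vee,10,\mathtt W_1^\vee]$ means the continued fraction of the concatenated sequence.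
   Formalization: The ''if'' part is false as stated (m=2, q=1: 4/1=[4]; m=29, q=1); it is replaced by: some coprime 0<q<m admits such a splitting if and only if m is the strict maximum of a Markov triple whose other two entries exceed 1. *)

(* Defs.v *)
From mathcomp Require Import all_boot all_order all_algebra.

Set Implicit Arguments.
Unset Strict Implicit.
Unset Printing Implicit Defensive.

Definition markov_triple (x y z : nat) : Prop :=
  [/\ 0 < x, 0 < y, 0 < z & x ^ 2 + y ^ 2 + z ^ 2 = 3 * x * y * z].

Definition markov_number (m : nat) : Prop := exists x y, markov_triple x y m.

(* The value 0 on the empty sequence is a dummy: the chains below represent
   rationals greater than 1, so none of them is empty. *)
Fixpoint hj (e : seq nat) : rat :=
  match e with
  | [::] => 0%R
  | [:: x] => x%:R%R
  | x :: e' => (x%:R - (hj e')^-1)%R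
  end.

Definition is_chain (r : rat) (e : seq nat) : Prop :=
  all (leq 2) e /\ hj e = r.

Definition wahl_frac (n a : nat) : rat :=
  (n%:R ^+ 2 / (n%:R * a%:R - 1))%R.

Definition dual_wahl_frac (n a : nat) : rat :=
  (n%:R ^+ 2 / (n%:R ^+ 2 - n%:R * a%:R + 1))%R.

Definition wahl_of (n a : nat) (W : seq nat) : Prop :=
  [/\ 0 < a < n, coprime a n & is_chain (wahl_frac n a) W].

Definition wahl_chain (W : seq nat) : Prop := exists n a, wahl_of n a W.

(* W determines n and a, because gcd(n^2, na - 1) = 1; hence W has exactly one
   dual chain V. *)
Definition dual_wahl (W V : seq nat) : Prop :=
  exists n a, wahl_of n a W /\ is_chain (dual_wahl_frac n a) V.

(* m^2 / (mq - 1) = [W0^dual, 10, W1^dual] *)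
Definition splits10 (m q : nat) (W0 W1 : seq nat) : Prop :=
  exists V0 V1, [/\ dual_wahl W0 V0, dual_wahl W1 V1
    & wahl_frac m q = hj (V0 ++ 10 :: V1)].

(* For a Markov number m only special q admit a splitting, and none may exist:
   such an m is the largest entry of a Markov triple without 1, whereas for
   instance 1, 2, 5 and 13 are largest only in triples containing 1. *)
Definition has_splitting10 (m q : nat) : Prop :=
  exists W0 W1, [/\ wahl_chain W0, wahl_chain W1, W0 <> [::], W1 <> [::]
    & splits10 m q W0 W1].

(* Main.v *)
Require Import Defs.
From mathcomp Require Import all_boot all_order all_algebra.
From mathcomp Require Import zify ring lra.

(** Write the convergents of a sequence e as the matrix in SL_2(Z) which is the
    product of the matrices [x, -1; 1, 0] over the entries x of e: its first
    column is the reduced fraction hj e, and prepending e to another sequence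
    acts on the value by the corresponding Moebius map (hj_moebius).  For the
    chain of n^2 / (n^2 - na + 1) this matrix is explicit (dual_wahl_moebius),
    and so is the one of [V0, 10, V1].  Comparing reduced fractions,
    m^2 / (mq - 1) = [V0, 10, V1] amounts to two integer equations
    m^2 = split_num and mq - 1 = split_den (splitting_equations).

    With D = 9 n0 n1 + n0 a1 - n1 a0 (split_factor) the first equation reads
    m^2 + n0^2 + n1^2 = n0 n1 D, so what has to be shown is D = 3m.  The
    second equation and the determinant relation give that m divides n1 D and
    n0 D, hence g D for g = gcd(n0, n1).  Then g also divides m, and dividing
    by g gives a solution of x^2 + y^2 + z^2 = t x y z with t = g D / m.
    Since 0 < a_i < n_i, D lies above 8 n0 n1, which yields 8 g^2 < t^2, so
    t >= 3; by Hurwitz's descent (hurwitz_no_solution) no solution has t > 3.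
    Hence t = 3 and g = 1, i.e. D = 3m (split_factor_eq).

    Conversely, for a Markov triple (n0, n1, m) with 1 < n0 < n1 < m put
    k = 3 n0 n1 - m, the other root of the Markov equation in m.  The condition
    D = 3m reads n1 a0 - n0 a1 = 3k, which determines a0 modulo n0.  Its
    solution with 0 < a0 < n0 has a1 in the right range because 3k < n1,
    and the number q then solves m a0 - n0 (m - q) = 3 n1, the analogous equation
    for the pair (n0, m).  Coprimality holds because Markov numbers in a triple
    are pairwise coprime and prime to 3 (markov_splitting_data). *)

Import Order.TTheory GRing.Theory Num.Theory.
Set Implicit Arguments.
Unset Strict Implicit.
Unset Printing Implicit Defensive.
Local Open Scope ring_scope.

(** * Hurwitz's descent *)

(** Vieta jumping: order the solution as x <= y <= z and replace z by the other
    root z' = txy - z.  If z' were at least z, then both roots of the quadratic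
    in z would be at least y, so its value at y would be nonnegative; but that
    value is x^2 + 2y^2 - t x y^2 <= 3y^2 - 4y^2. *)
Lemma hurwitz_no_solution (t x y z : int) :
  3 < t -> 0 < x -> 0 < y -> 0 < z ->
  x ^+ 2 + y ^+ 2 + z ^+ 2 <> t * x * y * z.
Proof.
move=> t3.
have [N] := ubnP `|(x + y + z)%R|%N; elim: N x y z => // N IH x y z.
wlog: x y z / x <= y.
  move=> H; case: (lerP x y) => [|/ltW] xy; first exact: H.
  move=> leN x0 y0 z0 E; apply: (H y x z) => //; lia.
wlog: x y z / y <= z.
  move=> H xy leN x0 y0 z0 E; case: (lerP y z) => yz; first exact: (H x y z).
  case: (lerP x z) => xz.
    by apply: (H x z y) => //; lia.
  by apply: (H z x y) => //; lia.
move=> yz xy leN x0 y0 z0 E.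
pose z' := t * x * y - z.
have zz' : z * z' = x ^+ 2 + y ^+ 2.
  rewrite /z' mulrBr; have -> : z * (t * x * y) = t * x * y * z by ring.
  by rewrite -E; ring.
have z'0 : 0 < z'.
  by rewrite -(pmulr_rgt0 _ z0) zz'; nia.
have z'z : z' < z.
  case: (ltrP z' z) => // zz''.
  have : (y - z) * (y - z') = y ^+ 2 + (x ^+ 2 + y ^+ 2) - t * x * y ^+ 2.
    by rewrite -zz' /z'; ring.
  have : 0 <= (y - z) * (y - z').
    by apply: mulr_le0; lia.
  have : t * x * y ^+ 2 >= 4 * y ^+ 2 by apply: ler_wpM2r; nia.
  have : x ^+ 2 <= y ^+ 2 by nia.
  have : y ^+ 2 > 0 by nia.
  lia.
apply: (IH x y z') => //; first by lia.
have -> : z' ^+ 2 = t * x * y * z' - z * z' by rewrite /z'; ring.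
by rewrite zz'; ring.
Qed.

(** * The two integer equations of a splitting *)

(** These four integers are, up to sign, the entries of the matrix
    [split_num, - split_conum; split_den, - split_coden] of [V0, 10, V1], where
    V_i is the chain of n_i^2 / (n_i^2 - n_i a_i + 1). *)
Definition split_num (n0 a0 n1 a1 : int) : int :=
  n0 ^+ 2 * (9 * n1 ^+ 2 + n1 * a1 - 1) - (n0 * a0 + 1) * n1 ^+ 2.

Definition split_den (n0 a0 n1 a1 : int) : int :=
  (n0 ^+ 2 - n0 * a0 + 1) * (9 * n1 ^+ 2 + n1 * a1 - 1)
  - (n0 * a0 + 1 - a0 ^+ 2) * n1 ^+ 2.

Definition split_conum (n0 a0 n1 a1 : int) : int :=
  (10 * n0 ^+ 2 - n0 * a0 - 1) * (n1 * a1 + 1)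
  - n0 ^+ 2 * (n1 * a1 + 1 - a1 ^+ 2).

Definition split_coden (n0 a0 n1 a1 : int) : int :=
  (10 * (n0 ^+ 2 - n0 * a0 + 1) - (n0 * a0 + 1 - a0 ^+ 2)) * (n1 * a1 + 1)
  - (n0 ^+ 2 - n0 * a0 + 1) * (n1 * a1 + 1 - a1 ^+ 2).

Lemma split_det n0 a0 n1 a1 :
  split_conum n0 a0 n1 a1 * split_den n0 a0 n1 a1
  - split_coden n0 a0 n1 a1 * split_num n0 a0 n1 a1 = 1.
Proof. by rewrite /split_conum /split_den /split_coden /split_num; ring. Qed.

Definition split_factor (n0 a0 n1 a1 : int) : int :=
  9 * n0 * n1 + n0 * a1 - n1 * a0.

Lemma split_numE n0 a0 n1 a1 :
  split_num n0 a0 n1 a1 + n0 ^+ 2 + n1 ^+ 2 = n0 * n1 * split_factor n0 a0 n1 a1.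
Proof. by rewrite /split_num /split_factor; ring. Qed.

(** The next two identities show that m divides n1 D and n0 D once
    split_num = m^2 and split_den = mq - 1: in that case m divides
    split_den + 1, and also split_conum + 1, by split_det. *)
Lemma split_factor_den n0 a0 n1 a1 :
  n1 * split_factor n0 a0 n1 a1 =
  (a0 - n0) * split_num n0 a0 n1 a1 + n0 * (split_den n0 a0 n1 a1 + 1).
Proof. by rewrite /split_num /split_den /split_factor; ring. Qed.

Lemma split_factor_conum n0 a0 n1 a1 :
  n0 * split_factor n0 a0 n1 a1 =
  n1 * (split_conum n0 a0 n1 a1 + 1) - a1 * split_num n0 a0 n1 a1.
Proof. by rewrite /split_num /split_conum /split_factor; ring. Qed.

(** With g = gcd(n0, n1), the quotient t = g D / m is an integer satisfying
    8 g^2 < t^2 and carrying a solution of x^2 + y^2 + z^2 = t x y z; Hurwitz's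
    descent leaves only t = 3 and g = 1. *)
Lemma split_factor_eq (n0 a0 n1 a1 m q : int) :
  0 < a0 < n0 -> 0 < a1 < n1 -> 0 < m ->
  m ^+ 2 = split_num n0 a0 n1 a1 -> m * q - 1 = split_den n0 a0 n1 a1 ->
  split_factor n0 a0 n1 a1 = 3 * m.
Proof.
move=> /andP[a0p a0n] /andP[a1p a1n] m0 HX HY.
have D8 : 8 * (n0 * n1) < split_factor n0 a0 n1 a1 by rewrite /split_factor; nia.
have HD := split_numE n0 a0 n1 a1; rewrite -HX in HD.
have := split_factor_den n0 a0 n1 a1; rewrite -HX -HY.
have := split_factor_conum n0 a0 n1 a1; have := split_det n0 a0 n1 a1.
rewrite -HX -HY.
move: (split_factor _ _ _ _) (split_conum _ _ _ _) (split_coden _ _ _ _) D8 HD.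
move=> D Q R D8 HD det dQ d1.
have {dQ}d0 : n0 * D = m * (n1 * (Q * q - R * m) - a1 * m).
  have Qm : Q + 1 = m * (Q * q - R * m).
    have -> : Q + 1 = Q + (Q * (m * q - 1) - R * m ^+ 2) by rewrite det.
    by ring.
  by rewrite dQ Qm; ring.
have {}d1 : n1 * D = m * ((a0 - n0) * m + n0 * q) by rewrite d1; ring.
have n0p : 0 < n0 by lia.
have n1p : 0 < n1 by lia.
(* A Bezout relation is what lifts divisibility by m from n0 D and n1 D to
   g D. *)
have [g [u [v [x [y [gp E0 E1 Eg]]]]]] : exists g u v x y : int,
    [/\ 0 < g, n0 = g * x, n1 = g * y & g = u * n0 + v * n1].
  have [u [v E]] := Bezoutz n0 n1.
  have /dvdzP[x Ex] := dvdz_gcdl n0 n1; have /dvdzP[y Ey] := dvdz_gcdr n0 n1.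
  exists (gcdz n0 n1), u, v, x, y; split => //; try by rewrite mulrC.
  by rewrite ltz_nat gcdn_gt0; apply/orP; left; lia.
have xp : 0 < x by rewrite -(pmulr_rgt0 _ gp) -E0.
have yp : 0 < y by rewrite -(pmulr_rgt0 _ gp) -E1.
have [t Et] : exists t, g * D = m * t.
  exists (u * (n1 * (Q * q - R * m) - a1 * m) + v * ((a0 - n0) * m + n0 * q)).
  have -> : g * D = u * (n0 * D) + v * (n1 * D) by rewrite {1}Eg; ring.
  by rewrite d0 d1; ring.
have /dvdzP[z Ez] : (g %| m)%Z.
  rewrite -(@dvdz_pexp2r _ _ 2) //; apply/dvdzP; exists (x * y * D - x ^+ 2 - y ^+ 2).
  have -> : m ^+ 2 = n0 * n1 * D - n0 ^+ 2 - n1 ^+ 2 by rewrite -HD; ring.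
  by rewrite E0 E1; ring.
have zp : 0 < z by rewrite -(pmulr_lgt0 _ gp) -Ez.
have Eq : x ^+ 2 + y ^+ 2 + z ^+ 2 = t * x * y * z.
  have g2 : g ^+ 2 != 0 by rewrite expf_neq0 //; lia.
  apply: (mulfI g2).
  have -> : g ^+ 2 * (x ^+ 2 + y ^+ 2 + z ^+ 2) = m ^+ 2 + n0 ^+ 2 + n1 ^+ 2.
    by rewrite E0 E1 Ez; ring.
  rewrite HD; have -> : n0 * n1 * D = (g * x) * y * (g * D) by rewrite E0 E1; ring.
  by rewrite Et Ez; ring.
have n01 : 0 < n0 * n1 by rewrite mulr_gt0.
have Dp : 0 < D by lia.
have tp : 0 < t by rewrite -(pmulr_rgt0 _ m0) -Et mulr_gt0.
(* (g D)^2 = (m t)^2 with m^2 < n0 n1 D and 8 n0 n1 < D. *)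
have bound : 8 * g ^+ 2 < t ^+ 2.
  have h : D * g ^+ 2 < n0 * n1 * t ^+ 2.
    rewrite -(ltr_pM2l Dp).
    have -> : D * (D * g ^+ 2) = (g * D) ^+ 2 by ring.
    have -> : D * (n0 * n1 * t ^+ 2) = n0 * n1 * D * t ^+ 2 by ring.
    rewrite Et exprMn -HD ltr_pM2r; last by rewrite exprn_gt0.
    by rewrite -addrA ltrDl addr_gt0 // exprn_gt0.
  rewrite -(ltr_pM2l n01); apply: le_lt_trans h.
  have -> : n0 * n1 * (8 * g ^+ 2) = 8 * (n0 * n1) * g ^+ 2 by ring.
  by rewrite ler_pM2r ?exprn_gt0 // ltW.
have t3 : t <= 3.
  by rewrite leNgt; apply/negP => t3; exact: hurwitz_no_solution t3 xp yp zp Eq.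
have g1 : g = 1 by clear - gp bound t3 tp; nia.
have tE : t = 3 by clear - bound t3 tp g1; nia.
by move: Et; rewrite g1 tE mul1r mulrC => ->.
Qed.

(** * Realizing a Markov triple *)
Lemma coprimez_combination (c x y u v : int) :
  c = u * x + v * y -> coprimez c y -> coprimez x y.
Proof.
move=> -> /coprimezP[[s t] /= E]; apply/coprimezP; exists (s * u, s * v + t).
by rewrite -[RHS]E /=; ring.
Qed.

(** Dividing the triple by g = gcd(x, y), which divides z as well, leaves a
    solution with coefficient 3g, and Hurwitz's descent forces g = 1. *)
Lemma markov_coprime (x y z : int) : 0 < x -> 0 < y -> 0 < z ->
  x ^+ 2 + y ^+ 2 + z ^+ 2 = 3 * x * y * z -> coprimez x y.
Proof.
move=> x0 y0 z0 E.
set g := gcdz x y.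
have gp : 0 < g by rewrite ltz_nat gcdn_gt0; apply/orP; left; lia.
have /dvdzP[x' Ex] : (g %| x)%Z by exact: dvdz_gcdl.
have /dvdzP[y' Ey] : (g %| y)%Z by exact: dvdz_gcdr.
have /dvdzP[z' Ez] : (g %| z)%Z.
  rewrite -(@dvdz_pexp2r _ _ 2) //; apply/dvdzP.
  exists (3 * x' * y' * z - x' ^+ 2 - y' ^+ 2).
  have -> : z ^+ 2 = 3 * x * y * z - x ^+ 2 - y ^+ 2 by rewrite -E; ring.
  by rewrite Ex Ey; ring.
suff : ~~ (1 < g) by rewrite /coprimez -/g; lia.
apply/negP => g1; apply: (@hurwitz_no_solution (3 * g) x' y' z').
- by lia.
- by rewrite -(pmulr_lgt0 _ gp) -Ex.
- by rewrite -(pmulr_lgt0 _ gp) -Ey.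
- by rewrite -(pmulr_lgt0 _ gp) -Ez.
apply: (@mulfI _ (g ^+ 2)); first by rewrite expf_neq0 //; lia.
transitivity (x ^+ 2 + y ^+ 2 + z ^+ 2); first by rewrite Ex Ey Ez; ring.
by rewrite E Ex Ey Ez; ring.
Qed.

Lemma sqr_sum_dvd3 (y z : int) :
  (3 %| y ^+ 2 + z ^+ 2)%Z -> (3 %| y)%Z.
Proof.
move=> /dvdzP[k E]; apply/dvdz_mod0P.
have := divz_eq y 3; have := divz_eq z 3.
have := modz_ge0 y (isT : (3 : int) != 0); have := ltz_pmod y (isT : (0 : int) < 3).
have := modz_ge0 z (isT : (3 : int) != 0); have := ltz_pmod z (isT : (0 : int) < 3).
move: (y %/ 3)%Z (z %/ 3)%Z (y %% 3)%Z (z %% 3)%Z => a b r s s3 s0 r3 r0 Ez Ey.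
have : r ^+ 2 + s ^+ 2 =
   3 * (k - 3 * a ^+ 2 - 2 * a * r - 3 * b ^+ 2 - 2 * b * s).
  have -> : r = y - a * 3 by lia.
  have -> : s = z - b * 3 by lia.
  have -> : 3 * (k - 3 * a ^+ 2 - 2 * a * (y - a * 3) - 3 * b ^+ 2 - 2 * b * (z - b * 3))
    = k * 3 - 9 * a ^+ 2 - 6 * a * (y - a * 3) - 9 * b ^+ 2 - 6 * b * (z - b * 3) by ring.
  by rewrite -E; ring.
move: (k - _ - _ - _ - _) => l El.
have Es : s = 0 \/ s = 1 \/ s = 2 by lia.
have Er : r = 0 \/ r = 1 \/ r = 2 by lia.
by case: Er El => [|[]] -> ; case: Es => [|[]] -> El; lia.
Qed.

(** If 3 divides x, then it divides y^2 + z^2, hence y, since -1 is not a square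
    modulo 3; this contradicts the coprimality of x and y. *)
Lemma markov_coprime3 (x y z : int) : 0 < x -> 0 < y -> 0 < z ->
  x ^+ 2 + y ^+ 2 + z ^+ 2 = 3 * x * y * z -> coprimez 3 x.
Proof.
move=> x0 y0 z0 E.
rewrite coprimezE prime_coprime // -dvdzE; apply/negP => dx.
have dy : (3 %| y)%Z.
  apply: (@sqr_sum_dvd3 y z).
  have -> : y ^+ 2 + z ^+ 2 = (3 * y * z - x) * x by rewrite mulrBl; lia.
  exact: dvdz_mull.
have : (3 %| gcdz x y)%Z by rewrite dvdz_gcd dx.
by rewrite (eqP (markov_coprime x0 y0 z0 E)).
Qed.

(** The equation n1 a0 - n0 a1 = 3k with k = 3 n0 n1 - m says that D = 3m.
    Solving it with 0 < a0 < n0 gives 0 < a1 because n1 a0 >= n1 > 3k, and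
    m - q is the integer b with b n0 = m a0 - 3 n1. *)
Lemma markov_splitting_data (n0 n1 m : int) : 1 < n0 -> n0 < n1 -> n1 < m ->
  n0 ^+ 2 + n1 ^+ 2 + m ^+ 2 = 3 * n0 * n1 * m ->
  exists a0 a1 q : int,
    [/\ [/\ 0 < a0 < n0, 0 < a1 < n1 & 0 < q < m],
        [/\ coprimez a0 n0, coprimez a1 n1 & coprimez q m],
        m ^+ 2 = split_num n0 a0 n1 a1 & m * q - 1 = split_den n0 a0 n1 a1].
Proof.
move=> n0_1 n01 n1m E.
have n0p : 0 < n0 by lia.
have n1p : 0 < n1 by lia.
have mp : 0 < m by lia.
pose k := 3 * n0 * n1 - m.
have mk : m * k = n0 ^+ 2 + n1 ^+ 2.
  have -> : m * k = 3 * n0 * n1 * m - m ^+ 2 by rewrite /k; ring.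
  by rewrite -E; ring.
have kp : 0 < k.
  by rewrite -(pmulr_rgt0 _ mp) mk addr_gt0 // exprn_gt0.
have Ek : n0 ^+ 2 + n1 ^+ 2 + k ^+ 2 = 3 * n0 * n1 * k.
  by rewrite -mk /k; ring.
have co01 := markov_coprime n0p n1p kp Ek.
have co3k0 : coprimez (3 * k) n0.
  rewrite coprimezMl (markov_coprime3 n0p n1p kp Ek) coprimez_sym.
  by apply: (@markov_coprime _ _ n1) => //; rewrite addrAC Ek; ring.
have co3k1 : coprimez (3 * k) n1.
  have E' : n1 ^+ 2 + k ^+ 2 + n0 ^+ 2 = 3 * n1 * k * n0.
    by rewrite addrC addrA Ek; ring.
  by rewrite coprimezMl (markov_coprime3 n1p kp n0p E') coprimez_sym
    (markov_coprime n1p kp n0p E').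
have co3n1m : coprimez (3 * n1) m.
  have E' : n1 ^+ 2 + m ^+ 2 + n0 ^+ 2 = 3 * n1 * m * n0.
    by rewrite addrC addrA E; ring.
  have E'' : m ^+ 2 + n0 ^+ 2 + n1 ^+ 2 = 3 * m * n0 * n1.
    by rewrite -addrA addrC E; ring.
  by rewrite coprimezMl (markov_coprime n1p mp n0p E')
    (markov_coprime3 mp n0p n1p E'').
(* k and m are the roots of Z^2 - 3 n0 n1 Z + n0^2 + n1^2, and this quadratic
   is negative at n1. *)
have kn1 : k < n1.
  have E1 : (m - n1) * (n1 - k) = (3 * n0 - 2) * n1 ^+ 2 - n0 ^+ 2.
    have -> : (m - n1) * (n1 - k) = n1 * (m + k) - m * k - n1 ^+ 2 by ring.
    by rewrite mk /k; ring.
  have mn1 : 0 < m - n1 by lia.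
  rewrite -subr_gt0 -(pmulr_rgt0 _ mn1) E1.
  by clear - n0_1 n01; nia.
(* Otherwise n1 * (3 * n0 * k - n1) = n0 ^+ 2 + k ^+ 2 would be at least
   n1 * 3 * (n0 - 1) * k >= n1 * k * (n0 + 1) > n0 ^+ 2 + k ^+ 2. *)
have n1k : 3 * k < n1.
  by rewrite ltNge; apply/negP => le; nia.
(* Reduce a Bezout solution modulo (n0, n1). *)
have [a0 [a1 [a0b Ea]]] : exists a0 a1 : int,
    0 <= a0 < n0 /\ n1 * a0 - n0 * a1 = 3 * k.
  have /coprimezP[[v u] /= uv] := co01.
  exists (3 * k * u %% n0)%Z, (- (3 * k * v) - (3 * k * u %/ n0)%Z * n1).
  rewrite modz_ge0 ?ltz_pmod //; last lia.
  split=> //; have := divz_eq (3 * k * u) n0.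
  move: (_ %/ _)%Z (_ %% _)%Z => d r Er.
  have -> : r = 3 * k * u - d * n0 by lia.
  by rewrite -[RHS]mulr1 -uv; ring.
have co0 : coprimez a0 n0.
  by apply: (@coprimez_combination (3 * k) _ _ n1 (- a1)) => //; rewrite -Ea; ring.
have co1 : coprimez a1 n1.
  by apply: (@coprimez_combination (3 * k) _ _ (- n0) a0) => //; rewrite -Ea; ring.
have {}a0b : 0 < a0 < n0.
  case/andP: a0b => a0b ->; rewrite lt_def a0b !andbT.
  by apply/eqP => a00; move: co0; rewrite a00 /coprimez gcd0z; lia.
have a1b : 0 < a1 < n1.
  by case/andP: a0b => a0l a0r; apply/andP; split; nia.
have ED : split_factor n0 a0 n1 a1 = 3 * m.
  have -> : split_factor n0 a0 n1 a1 = 9 * n0 * n1 - (n1 * a0 - n0 * a1).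
    by rewrite /split_factor; ring.
  by rewrite Ea /k; ring.
have EX : m ^+ 2 = split_num n0 a0 n1 a1.
  by have := split_numE n0 a0 n1 a1; rewrite ED; lia.
have /dvdzP[b Eb] : (n0 %| m * a0 - 3 * n1)%Z.
  rewrite -(Gauss_dvdzr _ co01); apply/dvdzP; exists (3 * n0 + m * a1).
  have -> : n1 * (m * a0 - 3 * n1) = m * (n1 * a0 - n0 * a1) + m * n0 * a1 - 3 * n1 ^+ 2.
    by ring.
  have -> : m * (n1 * a0 - n0 * a1) = 3 * (m * k) by rewrite Ea; ring.
  by rewrite mk; ring.
have bb : 0 < b < m.
  case/andP: a0b => a0l a0r.
  have m8 : 8 * (n0 * n1) < 3 * m.
    by rewrite -ED /split_factor; case/andP: a1b => a1l a1r; clear - a0l a0r n0p n1p a1l a1r; nia.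
  (* m > 8 n0 n1 / 3 with n0 >= 2. *)
  have m3 : 3 * n1 < m by clear - m8 n0_1 n1p; nia.
  apply/andP; split.
    rewrite -(pmulr_lgt0 _ n0p) -Eb.
    by have : m <= m * a0 by [rewrite ler_peMr //; lia]; lia.
  rewrite -(ltr_pM2r n0p) -Eb.
  by have : m * a0 < m * n0 by [rewrite ltr_pM2l]; lia.
exists a0, a1, (m - b); split => //.
- by split=> //; lia.
- split=> //; apply: (@coprimez_combination (3 * n1) _ _ n0 (a0 - n0)) => //.
  by rewrite mulrBr [n0 * b]mulrC -Eb; ring.
apply: (@mulfI _ n0); first lia.
have h := split_factor_den n0 a0 n1 a1; rewrite ED -EX in h.
have -> : n0 * (m * (m - b) - 1) = n0 * m ^+ 2 - m * (b * n0) - n0 by ring.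
rewrite -Eb.
have -> : n0 * split_den n0 a0 n1 a1 = n1 * (3 * m) - (a0 - n0) * m ^+ 2 - n0.
  by rewrite h; ring.
by ring.
Qed.

(** * Chains and their convergents *)

(** The dummy value 0 at the empty sequence and 0^-1 = 0 make this hold for
    one-element sequences too. *)
Lemma hj_cons x e : hj (x :: e) = x%:R - (hj e)^-1.
Proof. by case: e => //=; rewrite invr0 subr0. Qed.

Lemma cross_gt0 (R : realDomainType) (a b c d : R) :
  b < a -> 0 < a -> d < c -> 0 < d -> 0 < a * c - b * d.
Proof.
move=> ba a0 dc d0; rewrite subr_gt0.
by rewrite (@lt_trans _ _ (a * d)) ?ltr_pM2r ?ltr_pM2l.
Qed.

(** The numbers p, p', s, s' are the entries of the matrix
    [p, - p'; s, - s'] of V.  The inequalities are what an induction over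
    entries >= 2 preserves; they keep the denominators positive and make p / s
    and the residue p' of s^-1 modulo p canonical. *)
Lemma hj_moebius V : all (leq 2) V -> V <> [::] ->
  exists p p' s s' : int,
    [/\ [/\ 0 <= s' & s' <= p'], [/\ 0 < s, s < p & p' < p],
        s * p' - p * s' = 1, s - s' <= p - p' /\ hj V = p%:~R / s%:~R
      & forall e, 1 < hj e ->
        hj (V ++ e) = (p%:~R * hj e - p'%:~R) / (s%:~R * hj e - s'%:~R)].
Proof.
elim: V => // x V IH /andP[x2 V2] _.
have [->|/eqP V0] := eqVneq V [::].
  exists x%:Z, 1, 1, 0; split; [by []|split; lia|lia| |].
    by split; [lia|rewrite /= divr1 pmulrn].
  move=> e e1; rewrite [LHS](hj_cons x e).
  by rewrite mul1r subr0 -pmulrn; field; rewrite gt_eqF // (lt_trans ltr01).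
have [p [p' [s [s' [[s'0 s'p'] [sp s_p p'p] det [inc hV] G]]]]] := IH V2 V0.
exists (x%:Z * p - s), (x%:Z * p' - s'), p, p'; split.
- by split; nia.
- by split; nia.
- by rewrite -[RHS]det; ring.
- split; first by nia.
  rewrite hj_cons hV invf_div rmorphB rmorphM /= pmulrn.
  by field; rewrite intr_eq0; lia.
move=> e e1; rewrite [_ ++ _]/= hj_cons G // invf_div.
have pe : 0 < p%:~R * hj e - p'%:~R :> rat.
  by rewrite -[p'%:~R]mulr1 cross_gt0 ?ltr_int ?ltr0z //; lia.
rewrite !rmorphB !rmorphM /= pmulrn.
by field; rewrite lt0r_neq0.
Qed.

(** Euclid's algorithm with remainders taken from above:
    p = x s - r with 0 <= r < s, so that p / s = x - 1 / (s / r). *)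
Lemma chain_exists (p s : nat) : (0 < s < p)%N ->
  exists e, is_chain (p%:R / s%:R) e.
Proof.
have [N] := ubnP s; elim: N p s => // N IH p s sN /andP[s0 sp].
have s0' : s%:R != 0 :> rat by rewrite pnatr_eq0; lia.
have [/dvdnP[k pE]|ndv] := boolP (s %| p)%N.
  exists [:: k]; split; first by rewrite /= andbT; nia.
  by rewrite pE natrM mulfK.
pose r := ((p %/ s).+1 * s - p)%N.
have pE := divn_eq p s.
have md : (0 < p %% s < s)%N by rewrite ltn_mod s0 lt0n -/(dvdn s p) ndv.
have rE : (r + p = (p %/ s).+1 * s)%N by rewrite /r mulSn; lia.
have rlt : (0 < r < s)%N by rewrite mulSn in rE; lia.
have [||e [e2 he]] := IH s r; [by lia|by []|].
exists ((p %/ s).+1 :: e); split.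
  by rewrite /= e2 andbT; have : (0 < p %/ s)%N by rewrite divn_gt0 //; lia.
rewrite hj_cons he invf_div.
have : (r%:R + p%:R : rat) = (p %/ s).+1%:R * s%:R by rewrite -natrD rE natrM.
move=> h; apply: (mulIf s0'); rewrite mulrBl !divfK // -h.
by ring.
Qed.

(** Uniqueness of reduced fractions, with coprimality given by Bezout relations,
    since all fractions here come as columns of matrices of determinant 1. *)
Lemma lowest_terms (a b c d u v u' v' : int) :
  0 < a -> 0 < b -> 0 < c -> 0 < d ->
  u * a + v * b = 1 -> u' * c + v' * d = 1 ->
  a%:~R / b%:~R = c%:~R / d%:~R :> rat -> a = c /\ b = d.
Proof.
move=> a0 b0 c0 d0 ab cd.
move/eqP; rewrite eqr_div ?intr_eq0; [|lia|lia].
rewrite -!rmorphM /= eqr_int => /eqP E.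
have Ec : c = a * (u * c + v * d).
  have -> : a * (u * c + v * d) = u * a * c + v * (a * d) by ring.
  rewrite E; have -> : u * a * c + v * (c * b) = (u * a + v * b) * c by ring.
  by rewrite ab mul1r.
have Ea : a = c * (u' * a + v' * b).
  have -> : c * (u' * a + v' * b) = u' * c * a + v' * (c * b) by ring.
  rewrite -E; have -> : u' * c * a + v' * (a * d) = (u' * c + v' * d) * a by ring.
  by rewrite cd mul1r.
have ac : a = c.
  move: (u * c + v * d) (u' * a + v' * b) Ec Ea => k l Ec Ea.
  have k0 : 0 < k by rewrite -(pmulr_rgt0 _ a0) -Ec.
  have l0 : 0 < l by rewrite -(pmulr_rgt0 _ c0) -Ea.
  apply: le_anti; apply/andP; split.
    by rewrite Ec ler_peMr //; lia.
  by rewrite Ea ler_peMr //; lia.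
split=> //; subst c; symmetry; apply: (mulfI _ E); lia.
Qed.

(** * Wahl chains *)
Lemma wahl_fracE n a :
  wahl_frac n a = (n%:Z ^+ 2)%:~R / (n%:Z * a%:Z - 1)%:~R.
Proof.
by rewrite /wahl_frac !(rmorphXn, rmorphD, rmorphN, rmorphM, rmorph1) /= -!pmulrn.
Qed.

Lemma wahl_frac_det (n a : int) :
  a ^+ 2 * n ^+ 2 + - (n * a + 1) * (n * a - 1) = 1.
Proof. by ring. Qed.

(** The value of V fixes the first column of its matrix.  The entry p' is then
    the inverse of s modulo p in the range 0 <= p' < p, that is na + 1, and the
    determinant gives s'. *)
Lemma dual_wahl_moebius (n a : nat) V : (0 < a < n)%N ->
  is_chain (dual_wahl_frac n a) V ->
  let p := n%:Z ^+ 2 in let p' := n%:Z * a%:Z + 1 in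
  let s := n%:Z ^+ 2 - n%:Z * a%:Z + 1 in
  let s' := n%:Z * a%:Z + 1 - a%:Z ^+ 2 in
  forall e, 1 < hj e ->
    hj (V ++ e) = (p%:~R * hj e - p'%:~R) / (s%:~R * hj e - s'%:~R).
Proof.
move=> /andP[a0 an] [V2 hV] p p' s s'.
have pp : 0 < p by rewrite exprn_gt0; lia.
have sp : 0 < s by rewrite /s; nia.
have p'p : 0 <= p' < p by apply/andP; split; rewrite /p' /p; nia.
have det : s * p' - p * s' = 1 by rewrite /s /s' /p /p'; ring.
have fracE : dual_wahl_frac n a = p%:~R / s%:~R.
  by rewrite /dual_wahl_frac /p /s !(rmorphXn, rmorphD, rmorphN, rmorphM, rmorph1) /= -!pmulrn.
have V0 : V <> [::].
  move=> V0; move: hV; rewrite V0 fracE /=; apply/eqP.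
  by rewrite eq_sym mulf_neq0 ?invr_eq0 ?intr_eq0; lia.
have [r [r' [t [t' [[t0 t'r'] [tp tr r'r] det' [_ hV'] G]]]]] := hj_moebius V2 V0.
rewrite fracE hV' in hV.
have [||||||rp ts] := lowest_terms (u := - t') (v := r') (u' := - s') (v' := p') _ _ _ _ _ _ hV;
  try lia.
subst r t.
have d0 : r' = p'.
  have Ed : s * (r' - p') = p * (t' - s') by lia.
  have : r' - p' = p * ((t' - s') * p' - (r' - p') * s').
    have -> : p * ((t' - s') * p' - (r' - p') * s') =
       p * (t' - s') * p' - (r' - p') * (p * s') by ring.
    by rewrite -Ed -[LHS]mulr1 -det; ring.
  move: (_ * p' - _) => w Ew.
  have -> : r' = p' + p * w by lia.
  suff -> : w = 0 by rewrite mulr0 addr0.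
  by clear - Ew pp p'p r'r t0 t'r'; nia.
have t's' : t' = s'.
  by apply: (@mulfI _ p); [lia | rewrite d0 in det'; lia].
by rewrite d0 t's' in G.
Qed.

Lemma moebius_frac (F : fieldType) (p p' s s' c d : F) : d != 0 ->
  (p * (c / d) - p') / (s * (c / d) - s') = (p * c - p' * d) / (s * c - s' * d).
Proof.
move=> d0; have E x y : x * (c / d) - y = (x * c - y * d) / d by field.
by rewrite !E invf_div mulrA divfK.
Qed.

(** Both m^2 / (mq - 1) and split_num / split_den are reduced, so that equality
    of the rationals is equality of numerators and denominators. *)
Lemma splitting_equations (m q n0 a0 n1 a1 : nat) V0 V1 :
  (0 < q < m)%N -> (0 < a0 < n0)%N -> (0 < a1 < n1)%N ->
  is_chain (dual_wahl_frac n0 a0) V0 -> is_chain (dual_wahl_frac n1 a1) V1 ->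
  wahl_frac m q = hj (V0 ++ 10%N :: V1) <->
  m%:Z ^+ 2 = split_num n0 a0 n1 a1 /\ m%:Z * q - 1 = split_den n0 a0 n1 a1.
Proof.
move=> /andP[q0 qm] a0n0 a1n1 V0c [_ V1h].
have S0 : 0 < n1%:Z ^+ 2 by rewrite exprn_gt0; lia.
have SP : n1%:Z ^+ 2 < 9 * n1%:Z ^+ 2 + n1%:Z * a1%:Z - 1 by nia.
have hE : hj (10%N :: V1) = (9 * n1%:Z ^+ 2 + n1%:Z * a1%:Z - 1)%:~R / (n1%:Z ^+ 2)%:~R.
  rewrite hj_cons V1h /dual_wahl_frac invf_div.
  rewrite !(rmorphXn, rmorphD, rmorphN, rmorphM, rmorph1) /= -!pmulrn.
  by field; rewrite pnatr_eq0; lia.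
have h1 : 1 < hj (10%N :: V1).
  by rewrite hE ltr_pdivlMr ?ltr0z // mul1r ltr_int.
have X0 : 0 < split_num n0 a0 n1 a1.
  by apply: cross_gt0 => //; case/andP: a0n0 => a0l a0r; clear - a0l a0r; nia.
have Y0 : 0 < split_den n0 a0 n1 a1.
  by apply: cross_gt0 => //; case/andP: a0n0 => a0l a0r; clear - a0l a0r; nia.
have hS : hj (V0 ++ 10%N :: V1)
    = (split_num n0 a0 n1 a1)%:~R / (split_den n0 a0 n1 a1)%:~R.
  rewrite (dual_wahl_moebius a0n0 V0c) // hE.
  rewrite moebius_frac ?intr_eq0; last lia.
  by rewrite /split_num /split_den !(rmorphB, rmorphM).
rewrite hS wahl_fracE; split=> [|[-> ->] //].
apply: (lowest_terms (u := q%:Z ^+ 2) (v := - (m%:Z * q + 1))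
  (u' := - split_coden n0 a0 n1 a1) (v' := split_conum n0 a0 n1 a1)) => //.
- by rewrite exprn_gt0; lia.
- by nia.
- exact: wahl_frac_det.
by rewrite -[RHS](split_det n0 a0 n1 a1); ring.
Qed.

(** The fraction n^2 / (na - 1) is reduced. *)
Lemma wahl_of_inj (n a n' a' : nat) W :
  wahl_of n a W -> wahl_of n' a' W -> n = n' /\ a = a'.
Proof.
move=> [/andP[a0 an] _ [_ h]] [/andP[a0' an'] _ [_]]; rewrite h !wahl_fracE.
have n2 : 0 < n%:Z ^+ 2 by rewrite exprn_gt0; lia.
have n2' : 0 < n'%:Z ^+ 2 by rewrite exprn_gt0; lia.
have d2 : 0 < n%:Z * a%:Z - 1 by nia.
have d2' : 0 < n'%:Z * a'%:Z - 1 by nia.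
move=> /(lowest_terms n2 d2 n2' d2' (wahl_frac_det n a) (wahl_frac_det n' a')).
case=> /eqP nn na.
have {}nn : n = n' by move: nn; rewrite eqrXn2 //; lia.
by split=> //; subst n'; nia.
Qed.

Lemma wahl_chain_exists (n a : nat) : (0 < a < n)%N ->
  exists W, is_chain (wahl_frac n a) W.
Proof.
move=> /andP[a0 an].
have [|W h] := @chain_exists (n ^ 2) (n * a - 1); first by nia.
exists W; rewrite /wahl_frac -natrX -natrM -(@natrB _ _ 1) //; nia.
Qed.

Lemma dual_wahl_chain_exists (n a : nat) : (0 < a < n)%N ->
  exists V, is_chain (dual_wahl_frac n a) V.
Proof.
move=> /andP[a0 an].
have [|V h] := @chain_exists (n ^ 2) (n ^ 2 - n * a + 1); first by nia.
exists V; rewrite /dual_wahl_frac -natrX -natrM -natrB; last nia.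
by rewrite -(@natrD _ _ 1).
Qed.

Lemma wahl_of_nonnil n a W : wahl_of n a W -> W <> [::].
Proof.
move=> [/andP[a0 an] _ [_ h]] W0; move: h; rewrite W0 wahl_fracE /=.
by apply/eqP; rewrite eq_sym mulf_neq0 ?invr_eq0 ?intr_eq0; nia.
Qed.

(** * Splittings and Markov triples *)

(** The bounds n_i < m come from 8 n0 n1 < D = 3m. *)
Lemma splits10_markov (m q n0 a0 n1 a1 : nat) W0 W1 :
  (0 < q < m)%N -> splits10 m q W0 W1 ->
  wahl_of n0 a0 W0 -> wahl_of n1 a1 W1 ->
  [/\ markov_triple n0 n1 m, (1 < n0 < m)%N & (1 < n1 < m)%N].
Proof.
move=> qm [V0 [V1 [[n [a [w0 c0]]] [n' [a' [w1 c1]]] h]]] w0' w1'.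
have [En Ea] := wahl_of_inj w0 w0'; have [En' Ea'] := wahl_of_inj w1 w1'.
subst n a n' a' => {w0' w1'}.
case: w0 w1 => b0 _ _ [b1 _ _].
have [EX EY] := (splitting_equations qm b0 b1 c0 c1).1 h.
have D3 : split_factor n0 a0 n1 a1 = 3 * m%:Z by apply: split_factor_eq EX EY; lia.
have := split_numE n0 a0 n1 a1; rewrite D3 -EX => E.
have D8 : 8 * (n0%:Z * n1) < 3 * m%:Z.
  rewrite -D3 /split_factor; case/andP: b0 b1 => x y /andP[z t].
  by clear - x y z t; nia.
have [n0g n1g] : (1 < n0)%N /\ (1 < n1)%N by lia.
split; [by split; lia | |].
- by rewrite n0g; clear - D8 n0g n1g; nia.
- by rewrite n1g; clear - D8 n0g n1g; nia.
Qed.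

(** The entries x and y are distinct, being coprime and greater than 1, so that
    after exchanging them x < y < m. *)
Lemma markov_has_splitting10 (x y m : nat) :
  markov_triple x y m -> (1 < x < m)%N -> (1 < y < m)%N ->
  exists q : nat, [/\ (0 < q < m)%N, coprime q m & has_splitting10 m q].
Proof.
wlog xy : x y / (x <= y)%N.
  move=> H T bx by_; case: (leqP x y) => [|/ltnW] xy; first exact: (H x y).
  apply: (H y x) => //; case: T => x0 y0 m0 E; split=> //.
  by lia.
case=> x0 y0 m0 E /andP[x1 xm] /andP[y1 ym].
have Ez : x%:Z ^+ 2 + y%:Z ^+ 2 + m%:Z ^+ 2 = 3 * x%:Z * y * m by lia.
have {}xy : (x < y)%N.
  rewrite ltn_neqAle xy andbT; apply/eqP => exy; subst y.
  have := @markov_coprime x x m x0 x0 m0 Ez.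
  by rewrite coprimezE /coprime gcdnn /=; lia.
have [a0 [a1 [q [[b0 b1 bq] [c0 c1 cq] EX EY]]]] :=
  @markov_splitting_data x y m x1 xy ym Ez.
case: a0 b0 c0 EX EY => // a0 b0 c0 EX EY.
case: a1 b1 c1 EX EY => // a1 b1 c1 EX EY.
case: q bq cq EX EY => // q bq cq EX EY.
have [W0 w0] := wahl_chain_exists b0; have [W1 w1] := wahl_chain_exists b1.
have [V0 v0] := dual_wahl_chain_exists b0.
have [V1 v1] := dual_wahl_chain_exists b1.
have wo0 : wahl_of x a0 W0 by [].
have wo1 : wahl_of y a1 W1 by [].
exists q; split=> //; exists W0, W1; split.
- by exists x, a0.
- by exists y, a1.
- exact: wahl_of_nonnil wo0.
- exact: wahl_of_nonnil wo1.
exists V0, V1; split; [by exists x, a0|by exists y, a1|].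
exact/(splitting_equations bq b0 b1 v0 v1).
Qed.

Local Close Scope ring_scope.

Theorem theorem1p10 (m : nat) :
  [/\ forall q : nat, 0 < q < m -> coprime q m ->
        has_splitting10 m q -> markov_number m,
      (exists q : nat, [/\ 0 < q < m, coprime q m & has_splitting10 m q]) <->
        (exists x y : nat, [/\ markov_triple x y m, 1 < x < m & 1 < y < m])
    & forall (q : nat) (W0 W1 : seq nat) (n0 a0 n1 a1 : nat),
        0 < q < m -> coprime q m -> splits10 m q W0 W1 ->
        wahl_of n0 a0 W0 -> wahl_of n1 a1 W1 ->
        n0 ^ 2 + n1 ^ 2 + m ^ 2 = 3 * n0 * n1 * m].
Proof.
split.
- move=> q qm _ [W0 [W1 [[n0 [a0 w0]] [n1 [a1 w1]] _ _ h]]].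
  by have [T _ _] := splits10_markov qm h w0 w1; exists n0, n1.
- split=> [[q [qm _ [W0 [W1 [[n0 [a0 w0]] [n1 [a1 w1]] _ _ h]]]]]|].
    by exists n0, n1; exact: splits10_markov qm h w0 w1.
  by move=> [x [y [T bx by_]]]; exact: markov_has_splitting10 T bx by_.
move=> q W0 W1 n0 a0 n1 a1 qm _ h w0 w1.
by have [[]] := splits10_markov qm h w0 w1.
Qed.
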